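(* Let $p,q$ be two relatively prime integers, $p\neq 0$, and let $n_1,n_2\in\mathbb Z/p\mathbb Z$. (a) If $d(L(p,q),n_1)=d(L(p,q),n_2)$ then $$p \mid 2(n_1-n_2)(n_1+n_2-q+1).$$ (b) If $d(L(p,q),n_1)=-d(L(p,q),n_2)$ then $$p \mid \left((n_1-n_2)^2+(n_1+n_2-q+1)^2\right).$$
   Context: Heegaard Floer correction terms. For a rational homology $3$-sphere $Y$ with a spin$^{\mathbb C}$-structure $\mathfrak s$, $d(Y,\mathfrak s)\in\mathbb Q$ denotes the Heegaard Floer correction term of Ozsváth and Szabó; it satisfies $d(-Y,\mathfrak s)=-d(Y,\mathfrak s)$. For $p>0$ the set of spin$^{\mathbb C}$-structures of the lens space $L(p,q)$ (oriented so that it is $p/q$-surgery on the unknot in $S^3$) is identified with $H^2(L(p,q);\mathbb Z)\cong\mathbb Z/p\mathbb Z$ by the Ozsváth–Szabó labelling, and one writes $d(L(p,q),n)$ for $n\in\mathbb Z/p\mathbb Z$. For $p>0$ these numbers depend on $q$ and $n$ only modulo $p$ (since $L(p,q+kp)\cong L(p,q)$ for $k\in\mathbb Z$), satisfy $d(L(1,1),0)=0$, and by a theorem of Ozsváth and Szabó satisfy, for all relatively prime $0<q<p$ and $0\le n<p+q$, $$d(L(p,q),n)+d(L(q,p),n)=\frac14+\frac{n^2}{pq}+n\left(\frac1{pq}-\frac1q-\frac1p\right)+\frac14\left(\frac pq+\frac1{pq}+\frac qp\right)-\frac1{2q}-\frac1{2p}.$$ These properties determine all $d(L(p,q),n)$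 for relatively prime $p>0$ and $q$. For $p<0$ one uses $L(p,q)\cong -L(|p|,q)$ with the labelling of spin$^{\mathbb C}$-structures of $L(|p|,q)$, so that $d(L(p,q),n)=-d(L(|p|,q),n)$. The divisibility conditions are understood for any integer representatives of $n_1,n_2$ (they depend only on the classes modulo $p$). *)

(* Defs.v *)
From mathcomp Require Import all_boot all_order all_algebra.
From mathcomp Require Import zify ring lra.

Set Implicit Arguments.
Unset Strict Implicit.
Unset Printing Implicit Defensive.

Import Order.TTheory GRing.Theory Num.Theory.
Local Open Scope ring_scope.

Definition lens_reciprocity_rhs (p q n : int) : rat :=
  let P := p%:Q in let Q := q%:Q in let N := n%:Q in
  1 / 4 + N ^+ 2 / (P * Q) + N * (1 / (P * Q) - 1 / Q - 1 / P)
  + 1 / 4 * (P / Q + 1 / (P * Q) + Q / P) - 1 / (2 * Q) - 1 / (2 * P).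

(* [d p q n] stands for the Heegaard Floer correction term d(L(p,q), n).  A
   class in Z/pZ is given by an arbitrary integer representative [n].  The
   fields are the properties of the Ozsvath-Szabo correction terms that pin
   them down; nothing is required when p = 0 or gcd(p, q) <> 1, where L(p,q)
   is not a rational homology sphere or is not defined.  Such a [d] exists
   ([lens_correction_terms_exist]) and is unique for coprime p <> 0 and q
   ([lens_correction_terms_unique]). *)
Record lens_correction_terms (d : int -> int -> int -> rat) : Prop := {
  lens_d_mod : forall p q q' n n' : int,
    0 < p -> coprimez p q ->
    (q = q' %[mod p])%Z -> (n = n' %[mod p])%Z ->
    d p q n = d p q' n';
  lens_d_sphere : d 1 1 0 = 0;
  lens_d_reciprocity : forall p q n : int,
    0 < q -> q < p -> coprimez p q -> 0 <= n -> n < p + q ->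
    d p q n + d q p n = lens_reciprocity_rhs p q n;
  lens_d_reverse : forall p q n : int,
    p < 0 -> coprimez p q -> d p q n = - d `|p| q n
}.

Lemma coprimez_modz (p q : int) : coprimez p (q %% p)%Z = coprimez p q.
Proof. by rewrite /coprimez gcdz_modr. Qed.

Lemma coprimez_modz_gt0 (p q : int) :
  1 < p -> coprimez p q -> 0 < (q %% p)%Z < p.
Proof.
move=> p1 cpq; rewrite ltz_pmod ?andbT; last by lia.
rewrite lt_neqAle modz_ge0 ?andbT; last by lia.
apply/eqP => e; move: cpq; rewrite -coprimez_modz -e /coprimez gcdz0; lia.
Qed.

(* The Euclidean algorithm on (p, q), with fuel [k] >= p. *)
Fixpoint lens_d_rec (k : nat) (p q n : int) : rat :=
  if k is k'.+1 then
    if p == 1 then 0 else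
    lens_reciprocity_rhs p (q %% p)%Z (n %% p)%Z
      - lens_d_rec k' (q %% p)%Z p (n %% p)%Z
  else 0.

Lemma lens_d_rec_mod k p q q' n n' :
  (q = q' %[mod p])%Z -> (n = n' %[mod p])%Z ->
  lens_d_rec k p q n = lens_d_rec k p q' n'.
Proof. by case: k => [|k] //= -> ->. Qed.

Lemma lens_d_rec_fuel k l (p q n : int) :
  0 < p -> p <= k%:Z -> p <= l%:Z -> coprimez p q ->
  lens_d_rec k p q n = lens_d_rec l p q n.
Proof.
elim: k l p q n => [|k IH] [|l] p q n p0 pk pl cpq //; try lia.
rewrite /=; case: eqVneq => // p1.
have /andP[q0 qp] := @coprimez_modz_gt0 p q ltac:(lia) cpq.
by congr (_ - _); apply: IH; rewrite 1?coprimez_sym ?coprimez_modz //; lia.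
Qed.

Lemma lens_d_rec_shift k (p q n : int) :
  0 < p -> p <= k%:Z -> coprimez p q -> 0 <= n < p ->
  lens_d_rec k p q (n + q) - lens_d_rec k p q n = (2 * n + 1 - p)%:Q / p%:Q.
Proof.
elim: k p q n => [|k IH] p q n p0 pk cpq nP; first by lia.
rewrite /=; case: eqVneq => [p1|p1].
  have -> : n = 0 by lia.
  by rewrite p1.
have /andP[q0 qp] := @coprimez_modz_gt0 p q ltac:(lia) cpq.
have cqp : coprimez (q %% p)%Z p by rewrite coprimez_sym coprimez_modz.
rewrite -(modzDmr n q) (@modz_small n) //.
move: (q %% p)%Z q0 qp cqp => r r0 rp crp.
have P0 : p%:Q != 0 by rewrite intr_eq0; lia.
have R0 : r%:Q != 0 by rewrite intr_eq0; lia.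
case: (ltP (n + r) p) => h.
  rewrite modz_small; last by lia.
  rewrite (@lens_d_rec_mod k r p p (n + r) n) //; last by rewrite modzDr.
  by rewrite /lens_reciprocity_rhs !(rmorphD, rmorphB, rmorphM) /=; field; apply/andP.
have -> : ((n + r) %% p)%Z = n + r - p.
  by rewrite -{1}(subrK p (n + r)) modzDr modz_small //; lia.
have := IH r p (n + r - p) r0 ltac:(lia) crp ltac:(lia).
rewrite subrK (@lens_d_rec_mod k r p p (n + r) n) //; last by rewrite modzDr.
move: (lens_d_rec _ _ _ _) (lens_d_rec _ _ _ _) => x y /(canRL (subrK _)) ->.
by rewrite /lens_reciprocity_rhs !(rmorphD, rmorphB, rmorphM, rmorphN) /=; field; apply/andP.
Qed.

Definition lens_d_euclid (p q n : int) : rat :=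
  if p < 0 then - lens_d_rec `|p|%N (- p) q n else lens_d_rec `|p|%N p q n.

Lemma lens_d_euclid_pos (p q n : int) :
  0 < p -> lens_d_euclid p q n = lens_d_rec `|p|%N p q n.
Proof. by move=> p0; rewrite /lens_d_euclid ltNge ltW. Qed.

Lemma lens_d_euclid_neg (p q n : int) :
  p < 0 -> lens_d_euclid p q n = - lens_d_rec `|p|%N (- p) q n.
Proof. by rewrite /lens_d_euclid => ->. Qed.

Lemma lens_correction_terms_exist : exists d, lens_correction_terms d.
Proof.
pose e p q n := lens_d_rec `|p|%N p q n.
exists lens_d_euclid; split.
- move=> p q q' n n' p0 _ hq hn; rewrite !lens_d_euclid_pos //.
  exact: lens_d_rec_mod.
- by [].
- move=> p q n q0 qp cpq n0 npq.
  rewrite !lens_d_euclid_pos //; last by lia.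
  rewrite -/(e p q n) -/(e q p n).
  have small m : 0 <= m < p -> e p q m + e q p m = lens_reciprocity_rhs p q m.
    move=> mp; rewrite /e; case E: `|p|%N => [|k] /=; first by lia.
    rewrite ifF; last by lia.
    rewrite !modz_small //; last by lia.
    rewrite (@lens_d_rec_fuel k `|q|%N) ?subrK //; try lia.
    by rewrite coprimez_sym.
  have [np|pn] := ltP n p; first by apply: small; lia.
  have S := @lens_d_rec_shift `|q|%N q p (n - p) q0 ltac:(lia) _ ltac:(lia).
  rewrite coprimez_sym in cpq; move: (S cpq); rewrite subrK -/(e q p n).
  rewrite -/(e q p (n - p)) => /(canRL (subrK _)) ->.
  have -> : e p q n = e p q (n - p).
    by apply: lens_d_rec_mod; rewrite // -{1}(subrK p n) modzDr.
  have := small (n - p) ltac:(lia).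
  move=> /(canRL (addrK _)) ->.
  have P0 : p%:Q != 0 by rewrite intr_eq0; lia.
  have Q0 : q%:Q != 0 by rewrite intr_eq0; lia.
  by rewrite /lens_reciprocity_rhs !(rmorphD, rmorphB, rmorphM, rmorphN) /=; field; apply/andP.
- move=> p q n p0 _; rewrite lens_d_euclid_neg // ltr0_norm //.
  by rewrite lens_d_euclid_pos ?oppr_gt0 // abszN.
Qed.

Lemma lens_correction_terms_unique d d' :
  lens_correction_terms d -> lens_correction_terms d' ->
  forall p q n : int, p != 0 -> coprimez p q -> d p q n = d' p q n.
Proof.
move=> D D'.
have pos k (p q n : int) : 0 < p -> p <= k%:Z -> coprimez p q ->
    d p q n = d' p q n.
  elim: k p q n => [|k IH] p q n p0 pk cpq; first by lia.
  have [p1|p1] := eqVneq p 1.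
    have E f : lens_correction_terms f -> f p q n = 0.
      move=> F; rewrite -(lens_d_sphere F) p1.
      by apply: (lens_d_mod F); rewrite ?modz1 // -p1.
    by rewrite !E.
  have /andP[q0 qp] := @coprimez_modz_gt0 p q ltac:(lia) cpq.
  have cqp : coprimez (q %% p)%Z p by rewrite coprimez_sym coprimez_modz.
  have n0 := @modz_ge0 n p ltac:(lia); have np := ltz_pmod n p0.
  have E f : lens_correction_terms f -> f p q n =
      lens_reciprocity_rhs p (q %% p)%Z (n %% p)%Z
      - f (q %% p)%Z p (n %% p)%Z.
    move=> F; rewrite -(lens_d_reciprocity F) ?addrK ?coprimez_modz //; last by lia.
    by apply: (lens_d_mod F); rewrite // modz_mod.
  by rewrite (E d) // (E d') // IH //; lia.
move=> p q n p0 cpq; case: (ltP 0 p) => [pp|pn].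
  by apply: (pos `|p|%N) => //; lia.
have p_lt0 : p < 0 by rewrite lt_neqAle p0.
rewrite (lens_d_reverse D) // (lens_d_reverse D') // ltr0_norm //; congr (- _).
by apply: (pos `|p|%N); rewrite ?oppr_gt0 // /coprimez ?gcdNz //; lia.
Qed.

(* Main.v *)
Require Import Defs.
From mathcomp Require Import all_boot all_order all_algebra.
From mathcomp Require Import zify ring.

Import Order.TTheory GRing.Theory Num.Theory.
Local Open Scope ring_scope.

(** Reciprocity reads
    [4 p q (d(L(p,q),n) + d(L(q,p),n)) = (2n+1-p-q)^2 - p q].
    Running the Euclidean algorithm on it, [D(n) := 4 p d(L(p,q),n)] is an
    integer with [q D(n) = (2n-q+1)^2 (mod p)].  Comparing reciprocity at [n] and
    [n+q], where [d(L(q,p),_)] takes the same value, shows that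
    [E := p (d(L(p,q),n1) - d(L(p,q),n2))] is an integer with [q E = A (mod p)] for
    [A := (n1-n2)(n1+n2-q+1)].  If the two terms are equal then [E = 0], so [p]
    divides [A].  If they are opposite then [D(n1) = 2 E], so [2 A] is congruent to
    [(2 n1-q+1)^2 = S + 2 A], where [S] is the sum of squares, and [p] divides [S]. *)

Lemma lens_reciprocity_rhsE (p q n : int) : p != 0 -> q != 0 ->
  4 * p%:Q * q%:Q * lens_reciprocity_rhs p q n
    = ((2 * n + 1 - p - q) ^+ 2 - p * q)%:Q.
Proof.
move=> p0 q0; have P0 : p%:Q != 0 by rewrite intr_eq0.
have Q0 : q%:Q != 0 by rewrite intr_eq0.
rewrite /lens_reciprocity_rhs expr2 !(rmorphD, rmorphB, rmorphM, rmorphN) /=.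
by field; apply/andP.
Qed.

Section CorrectionTerms.

Variable d : int -> int -> int -> rat.
Hypothesis hd : lens_correction_terms d.

Lemma lens_d1 (q n : int) : d 1 q n = 0.
Proof.
by rewrite -(lens_d_sphere hd); apply: (lens_d_mod hd); rewrite ?modz1 ?/coprimez ?gcd1z.
Qed.

Lemma lens_d_modz (p q n : int) : 0 < p -> coprimez p q ->
  d p q n = d p (q %% p)%Z (n %% p)%Z.
Proof. by move=> p0 cpq; apply: (lens_d_mod hd) => //; rewrite modz_mod. Qed.

Lemma lens_d_quadratic (p q n : int) : 0 < p -> coprimez p q ->
  exists2 D : int, 4 * p%:Q * d p q n = D%:Q
    & (p %| q * D - (2 * n - q + 1) ^+ 2)%Z.
Proof.
have [k] := ubnP `|p|%N; elim: k p q n => // k IH p q n pk p0 cpq.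
have [->|p1] := eqVneq p 1; first by exists 0; rewrite ?lens_d1 ?mulr0 ?dvd1z.
have /andP[r0 rp] := @coprimez_modz_gt0 p q ltac:(lia) cpq.
have cpr : coprimez p (q %% p)%Z by rewrite coprimez_modz.
rewrite (@lens_d_modz p) //.
have m0 := @modz_ge0 n p ltac:(lia); have mp := ltz_pmod n p0.
have Eq := divz_eq q p; have En := divz_eq n p.
move: (q %% p)%Z (n %% p)%Z (q %/ p)%Z (n %/ p)%Z r0 rp cpr m0 mp Eq En.
move=> r m a b r0 rp cpr m0 mp -> ->.
have crp : coprimez r p by rewrite coprimez_sym.
have [D' ED' /dvdzP[c Ec]] := IH r p m ltac:(lia) r0 crp.
have Rp : r%:Q != 0 by rewrite intr_eq0; lia.
(* Solving reciprocity for [D] requires dividing by [r]; the induction hypothesis for [(r, p)] makes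
   the numerator in [ED] a multiple of [r], with this quotient. *)
pose D := r - 2 * (2 * m + 1 - p) - p - c.
have ED : r * D = (2 * m + 1 - p - r) ^+ 2 - p * r - p * D'.
  have -> : p * D' = c * r + (2 * m - p + 1) ^+ 2 by rewrite -Ec; ring.
  by rewrite /D; ring.
exists D.
  apply: (mulfI Rp); rewrite -rmorphM ED rmorphB /= -lens_reciprocity_rhsE; try lia.
  rewrite -(lens_d_reciprocity hd) //; last by lia.
  by rewrite rmorphM /= -ED'; ring.
(* For the unreduced [q] and [n], the number to square is [2 * m + 1 - r] plus [(2 * b - a) * p];
   the last product accounts for that shift, the other terms come from [ED]. *)
apply/dvdzP; exists (a * D - D' - r + p - 2 * (2 * m + 1 - r)
  - (2 * b - a) * (2 * (2 * m + 1 - r) + (2 * b - a) * p)).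
have -> : (a * p + r) * D = a * D * p + r * D by ring.
by rewrite ED; ring.
Qed.

Lemma lens_d_shift (p q n : int) : 0 < p -> coprimez p q ->
  exists2 E : int, p%:Q * (d p q (n + q) - d p q n) = E%:Q
    & (p %| E - (2 * n + 1))%Z.
Proof.
move=> p0 cpq.
have [->|p1] := eqVneq p 1; first by exists 0; rewrite ?lens_d1 ?subrr ?mulr0 ?dvd1z.
have /andP[r0 rp] := @coprimez_modz_gt0 p q ltac:(lia) cpq.
have cpr : coprimez p (q %% p)%Z by rewrite coprimez_modz.
have -> : d p q (n + q) = d p (q %% p)%Z ((n %% p)%Z + (q %% p)%Z).
  by apply: (lens_d_mod hd); rewrite ?modz_mod ?modzDm.
rewrite (@lens_d_modz p q n) //.
have m0 := @modz_ge0 n p ltac:(lia); have mp := ltz_pmod n p0.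
have En := divz_eq n p.
move: (q %% p)%Z (n %% p)%Z (n %/ p)%Z r0 rp cpr m0 mp En.
move=> r m b r0 rp cpr m0 mp ->.
(* The squares of [2 * m + 1 - p + r] and [2 * m + 1 - p - r] differ by [4 * r] times this. *)
exists (2 * m + 1 - p); last by apply/dvdzP; exists (- 1 - 2 * b); ring.
have P0 : p%:Q != 0 by rewrite intr_eq0; lia.
have R0 : r%:Q != 0 by rewrite intr_eq0; lia.
have /(canRL (addrK _)) -> := @lens_d_reciprocity d hd p r m r0 rp cpr m0 ltac:(lia).
(* Reciprocity holds for labels up to [p + r], so [m + r] is allowed even when it exceeds [p]. *)
have /(canRL (addrK _)) -> :=
  @lens_d_reciprocity d hd p r (m + r) r0 rp cpr ltac:(lia) ltac:(lia).
have -> : d r p (m + r) = d r p m.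
  by apply: (lens_d_mod hd); rewrite ?modzDr // coprimez_sym.
rewrite /lens_reciprocity_rhs !(rmorphD, rmorphB, rmorphM, rmorphN) /=.
by field; apply/andP.
Qed.

(** Telescoping: the sum of [2 * (n + q * j) + 1] over [j < k] is [k * (2 * n + q * k - q + 1)]. *)
Lemma lens_d_shiftn (p q n : int) (k : nat) : 0 < p -> coprimez p q ->
  exists2 E : int, p%:Q * (d p q (n + q * k%:Z) - d p q n) = E%:Q
    & (p %| q * E - q * k%:Z * (2 * n + q * k%:Z - q + 1))%Z.
Proof.
move=> p0 cpq; elim: k => [|k [E EE /dvdzP[a Ea]]].
  by exists 0; rewrite ?mulr0 ?addr0 ?subrr ?mulr0 ?mul0r ?subrr ?dvdz0.
have [F EF /dvdzP[b Eb]] := @lens_d_shift p q (n + q * k%:Z) p0 cpq.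
have -> : n + q * k.+1%:Z = n + q * k%:Z + q by rewrite -addn1 PoszD; ring.
exists (E + F); first by rewrite rmorphD /= -EE -EF; ring.
apply/dvdzP; exists (a + q * b).
have -> : (a + q * b) * p = a * p + q * (b * p) by ring.
by rewrite -Ea -Eb -addn1 PoszD; ring.
Qed.

(** As [q] is invertible modulo [p], steps of size [q] lead from [n2] to the class of [n1]. *)
Lemma lens_d_sub (p q n1 n2 : int) : 0 < p -> coprimez p q ->
  exists2 E : int, p%:Q * (d p q n1 - d p q n2) = E%:Q
    & (p %| q * E - (n1 - n2) * (n1 + n2 - q + 1))%Z.
Proof.
move=> p0 cpq; have /coprimezP[[u v] /= uv] := cpq.
(* The Bezout coefficient [v] inverts [q] modulo [p]; reducing makes the number of steps
   nonnegative. *)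
pose k := (((n1 - n2) * v) %% p)%Z.
have k0 : 0 <= k by rewrite modz_ge0; lia.
have [E] := @lens_d_shiftn p q n2 `|k|%N p0 cpq; rewrite gez0_abs // => EE /dvdzP[a Ea].
have [b Eb] : exists b, n2 + q * k = n1 + b * p.
  have Ek : k = (n1 - n2) * v - (((n1 - n2) * v) %/ p)%Z * p.
    by apply/eqP; rewrite eq_sym subr_eq [k + _]addrC -divz_eq.
  exists (- ((n1 - n2) * u) - q * (((n1 - n2) * v) %/ p)%Z).
  rewrite Ek; move: (_ %/ _)%Z => c.
  have -> : n2 + q * ((n1 - n2) * v - c * p)
      = n2 + (n1 - n2) * (v * q) - q * c * p by ring.
  have -> : v * q = 1 - u * p by rewrite -uv addrC addKr.
  by ring.
exists E.
  rewrite -EE Eb; congr (_ * (_ - _)).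
  by apply: (lens_d_mod hd); rewrite // addrC modzMDl.
apply/dvdzP; exists (a + b * (2 * n1 + b * p - q + 1)).
have {}Ea : q * E = a * p + q * k * (2 * n2 + q * k - q + 1) by rewrite -Ea; ring.
have {}Eb : q * k = n1 - n2 + b * p by lia.
by rewrite Ea Eb; ring.
Qed.

Lemma lens_d_eq_dvd (p q n1 n2 : int) : 0 < p -> coprimez p q ->
  d p q n1 = d p q n2 -> (p %| (n1 - n2) * (n1 + n2 - q + 1))%Z.
Proof.
move=> p0 cpq e; have [E] := @lens_d_sub p q n1 n2 p0 cpq.
rewrite e subrr mulr0 => /esym/eqP; rewrite intr_eq0 => /eqP ->.
by rewrite mulr0 sub0r rpredN.
Qed.

Lemma lens_d_opp_dvd (p q n1 n2 : int) : 0 < p -> coprimez p q ->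
  d p q n1 = - d p q n2 ->
  (p %| (n1 - n2) ^+ 2 + (n1 + n2 - q + 1) ^+ 2)%Z.
Proof.
move=> p0 cpq e; have [E EE /dvdzP[a Ea]] := @lens_d_sub p q n1 n2 p0 cpq.
have [D ED /dvdzP[b Eb]] := @lens_d_quadratic p q n1 p0 cpq.
have DE : D = 2 * E.
  apply: (@intr_inj rat); rewrite rmorphM /= -ED -EE.
  have -> : d p q n2 = - d p q n1 by rewrite e opprK.
  ring.
(* The terms in [D] and [E] cancel, and [2 * n1 - q + 1] is the sum of [n1 - n2] and
   [n1 + n2 - q + 1], so removing the double product leaves the two squares. *)
apply/dvdzP; exists (2 * a - b).
have -> : (2 * a - b) * p = 2 * (a * p) - b * p by ring.
by rewrite -Ea -Eb DE; ring.
Qed.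

End CorrectionTerms.

Theorem theorem1p4 (d : int -> int -> int -> rat)
    (hd : lens_correction_terms d)
    (p q : int) (hpq : coprimez p q) (hp : p != 0) (n1 n2 : int) :
  (d p q n1 = d p q n2 ->
     (p %| 2 * (n1 - n2) * (n1 + n2 - q + 1))%Z)
  /\ (d p q n1 = - d p q n2 ->
     (p %| (n1 - n2) ^+ 2 + (n1 + n2 - q + 1) ^+ 2)%Z).
Proof.
have p0 : 0 < `|p| by rewrite normr_gt0.
have cpq : coprimez `|p| q by rewrite -abszE.
(* Orientation reversal changes all terms by one common sign, which cancels from either equality. *)
have [s dE] : exists s : bool, forall n, d p q n = (-1) ^+ s * d `|p| q n.
  have [pn|pp] := ltP p 0.
    by exists true => n; rewrite (lens_d_reverse hd) // mulN1r.
  by exists false => n; rewrite mul1r ger0_norm.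
have abs_dvd m : (`|p| %| m)%Z = (p %| m)%Z by rewrite -abszE.
rewrite !dE -!abs_dvd -mulrA -mulrN; split=> /(can_inj (signrMK s)) e.
  by rewrite dvdz_mull // (@lens_d_eq_dvd d).
exact: (@lens_d_opp_dvd d).
Qed.
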